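(* Let $q$ be a prime power and $n$ a positive integer. For every monic irreducible polynomial $f\in\mathbb{F}_q[X]$ of degree $2n$, the number of $(2,n)$-block companion matrices $T$ over $\mathbb{F}_q$ with $\det(XI_{2n}-T)=f$ is $q^{2n-1}(q-1)$. In particular, for every primitive polynomial $f\in\mathbb{F}_q[X]$ of degree $2n$, the number of $(2,n)$-block companion Singer cycles $T$ over $\mathbb{F}_q$ with $\det(XI_{2n}-T)=f$ is $q^{2n-1}(q-1)$. Consequently, the number of $(2,n)$-block companion Singer cycles over $\mathbb{F}_q$ is $$\frac{\phi(q^{2n}-1)}{2n}\, q^{2n-1}(q-1),$$ and the number of $(2,n)$-block companion matrices over $\mathbb{F}_q$ whose characteristic polynomial is irreducible is $$\frac{1}{2n}\Big(\sum_{d\mid 2n}\mu\big(\tfrac{2n}{d}\big)q^d\Big)\, q^{2n-1}(q-1).$$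
   Context: For positive integers $m,n$, an $(m,n)$-block companion matrix over $\mathbb{F}_q$ is a matrix $T\in M_{mn}(\mathbb{F}_q)$ which, viewed as an $n\times n$ array of $m\times m$ blocks, has blocks $I_m$ in positions $(i+1,i)$ for $i=1,\dots,n-1$, arbitrary blocks $C_0,\dots,C_{n-1}\in M_m(\mathbb{F}_q)$ in the last block column (in rows $1,\dots,n$ respectively), and zero blocks elsewhere. An $(m,n)$-block companion Singer cycle is an $(m,n)$-block companion matrix that is nonsingular and has order $q^{mn}-1$ in the group $GL_{mn}(\mathbb{F}_q)$. A polynomial of degree $d\ge1$ in $\mathbb{F}_q[X]$ is primitive if it is the minimal polynomial over $\mathbb{F}_q$ of a generator of the cyclic group $\mathbb{F}_{q^d}^*$. Here $\phi$ is Euler's totient function and $\mu$ the Möbius function. *)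

(* Defs.v *)
From HB Require Import structures.
From mathcomp Require Import all_boot all_order all_fingroup all_algebra all_field.

Set Implicit Arguments.
Unset Strict Implicit.
Unset Printing Implicit Defensive.

Import Order.TTheory GRing.Theory Num.Theory.
Local Open Scope ring_scope.

(* mxvec_index i a : 'I_(n * m) has value i * m + a. *)
Definition mblock (F : finFieldType) (m n : nat) (T : 'M[F]_(n * m))
    (i j : 'I_n) : 'M[F]_m :=
  \matrix_(a, b) T (mxvec_index i a) (mxvec_index j b).

(* Block indices start at 0; the last block column j = n - 1 is free. *)
Definition block_companion (F : finFieldType) (m n : nat)
    (T : 'M[F]_(n * m)) : bool :=
  [forall i : 'I_n, forall j : 'I_n,
    (j.+1 < n)%N ==> (mblock T i j == if i == j.+1 :> nat then 1%:M else 0)].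

(* Order of T in GL_N(F), and 0 for singular T; the match on N is needed
   because {'GL_N[F]} consists of matrices of size N.-1.+1. *)
Definition GL_order (F : finFieldType) (N : nat) : 'M[F]_N -> nat :=
  if N is N'.+1 then
    fun T => if insub T is Some g then #[g : {'GL_N'.+1[F]}]%g else 0%N
  else fun=> 1%N.

Definition block_companion_singer (F : finFieldType) (m n : nat)
    (T : 'M[F]_(n * m)) : bool :=
  [&& block_companion T, T \in unitmx & GL_order T == (#|F| ^ (m * n) - 1)%N].

(* L is a model of the extension of F of degree deg f; its multiplicative group
   is finite, so natural exponents suffice to express that a generates it. *)
Definition primitive_polynomial (F : finFieldType) (f : {poly F}) : Prop :=
  exists (L : fieldExtType F) (a : L),
    [/\ (\dim {:L}).+1 = size f,
        a != 0,
        forall x : L, x != 0 -> exists k : nat, x = a ^+ k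
      & minPoly 1%VS a = map_poly (in_alg L) f].

Definition moebius (k : nat) : int :=
  if (0 < k)%N && all (fun p => logn p k == 1%N) (primes k)
  then (-1) ^+ size (primes k) else 0.

(* Main.v *)
Require Import Defs.
From HB Require Import structures.
From mathcomp Require Import all_boot all_order all_fingroup all_algebra all_field.
From mathcomp Require Import cyclic zify.

(** Let f be irreducible of degree 2n and let A be a matrix with characteristic
    polynomial f. Transposes of block companion matrices with characteristic
    polynomial f are the matrices of A in the bases of the form
    e, v, e A, v A, ..., e A^(n-1), v A^(n-1), and e may be fixed since F[A]^*
    acts transitively on nonzero vectors. Under e p(A) <-> p mod f, the vector v
    fails to give a basis iff v = a/b for polynomials a, b of degree < n. Let
    R_k(v) be the space of (a, b) of degrees < k with a = v b. Summing |R_k(v)|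
    over v is a count of pairs (a, b); on the other hand any two elements of
    R_n(v) are proportional over F(X), so that |R_n(v)| = q |R_(n-1)(v)| as soon
    as R_n(v) <> 0. Comparing the sums for n and n - 1 gives q^(2n-1) bad
    vectors v.

    The other counts follow by double counting pairs (T, x) with x a root of the
    characteristic polynomial of T in the extension L of F of degree 2n: T is a
    Singer cycle iff x generates L^*, and the elements of degree 2n over F are
    counted by Moebius inversion over the subfields of L. *)

Set Implicit Arguments.
Unset Strict Implicit.
Unset Printing Implicit Defensive.

Import Order.TTheory GRing.Theory Num.Theory.
Local Open Scope ring_scope.

(** * Polynomials in a matrix with irreducible characteristic polynomial *)

(** A Bezout relation between [char_poly A] and [p], evaluated at [A], loses its first term by
    Cayley-Hamilton and leaves an inverse of [p(A)]. *)
Lemma horner_mx_unit (F : fieldType) N (A : 'M[F]_N.+1) (p : {poly F}) :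
  irreducible_poly (char_poly A) -> ~~ (char_poly A %| p) -> horner_mx A p \in unitmx.
Proof.
move=> irrA; rewrite -irreducible_poly_coprime // => /Bezout_eq1_coprimepP[[u v]] /=.
move=> /(congr1 (horner_mx A)).
rewrite rmorphD !rmorphM /= Cayley_Hamilton mulr0 add0r rmorph1.
by case/mulmx1_unit.
Qed.

Lemma char_poly_ndvd (F : fieldType) N (A : 'M[F]_N) (p : {poly F}) :
  p != 0 -> (size p <= N)%N -> ~~ (char_poly A %| p).
Proof.
move=> nz_p sz_p; apply/negP => /(dvdp_leq nz_p).
by rewrite size_char_poly leqNgt ltnS sz_p.
Qed.

Lemma mul_horner_mx_eq0 (F : fieldType) N (A : 'M[F]_N.+1) (e : 'rV_N.+1)
    (p : {poly F}) :
  irreducible_poly (char_poly A) -> e != 0 ->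
  (e *m horner_mx A p == 0) = (char_poly A %| p).
Proof.
move=> irrA nz_e; apply/eqP/idP => [ep0 | /dvdpP[r ->]]; last first.
  by rewrite rmorphM /= Cayley_Hamilton mulr0 mulmx0.
apply: contraNT nz_e => ndiv; apply/eqP.
by rewrite -[e](mulmxK (horner_mx_unit irrA ndiv)) ep0 mul0mx.
Qed.

Lemma mul_horner_mx_inj0 (F : fieldType) N (A : 'M[F]_N.+1) (e : 'rV_N.+1)
    (p : {poly F}) :
  irreducible_poly (char_poly A) -> e != 0 -> (size p <= N.+1)%N ->
  e *m horner_mx A p = 0 -> p = 0.
Proof.
move=> irrA nz_e sz_p /eqP; rewrite mul_horner_mx_eq0 //.
by apply: contraTeq => nz_p; apply: char_poly_ndvd.
Qed.

Lemma horner_mx_intertwine (F : fieldType) N (A S M : 'M[F]_N.+1) p :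
  S *m M = M *m A -> horner_mx S p *m M = M *m horner_mx A p.
Proof.
move=> SM; elim/poly_ind: p => [|p c IH]; first by rewrite !rmorph0 mul0mx mulmx0.
rewrite !(rmorphD, rmorphM) /= !horner_mx_X !horner_mx_C mulmxDl mulmxDr scalar_mxC.
by rewrite -!mulmxE -mulmxA SM mulmxA IH -mulmxA.
Qed.

(** * Vectors as fractions of polynomials of small degree *)

Lemma rVpoly_eq0 (R : nzRingType) k (a : 'rV[R]_k) : (rVpoly a == 0) = (a == 0).
Proof. by rewrite -[X in _ == X](linear0 (@rVpoly R k)) (inj_eq (can_inj rVpolyK)). Qed.

Lemma size_rVpoly (R : nzSemiRingType) k (a : 'rV[R]_k) : (size (rVpoly a) <= k)%N.
Proof. exact: size_poly. Qed.

Lemma coefM_top (R : nzSemiRingType) k (p r : {poly R}) :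
  (size p <= k.+1)%N -> (size r <= k.+1)%N -> (p * r)`_(k + k) = p`_k * r`_k.
Proof.
move=> sp sr; rewrite coefM.
have lt_k : (k < (k + k).+1)%N by rewrite ltnS leq_addr.
rewrite (bigD1 (Ordinal lt_k)) //= addnK big1 ?addr0 // => i ne_ik.
have [lt_ik | le_ki] := ltnP i k.
  rewrite (nth_default 0 (s := r)) ?mulr0 // (leq_trans sr) //.
  by rewrite ltn_subRL ltn_add2r.
rewrite (nth_default 0 (s := p)) ?mul0r // (leq_trans sp) //.
rewrite ltn_neqAle le_ki andbT eq_sym.
by apply: contraNneq ne_ik => e_ik; apply/eqP/val_inj.
Qed.

(* [rational_pairs A e k v] collects the (a, b) with deg a, deg b < k such that
   v = a(A) / b(A) e once the row space is identified with the field F[A] by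
   means of the cyclic vector e. *)
Definition rational_pairs (F : finFieldType) N (A : 'M[F]_N.+1) (e : 'rV[F]_N.+1)
    k (v : 'rV[F]_N.+1) : {set 'rV[F]_k * 'rV[F]_k} :=
  [set ab | e *m horner_mx A (rVpoly ab.1) == v *m horner_mx A (rVpoly ab.2)].

Section RationalPairs.

Variables (F : finFieldType) (N : nat) (A : 'M[F]_N.+1) (e : 'rV[F]_N.+1).
Hypotheses (irrA : irreducible_poly (char_poly A)) (nz_e : e != 0).
Local Notation q := #|F|.
Local Notation R := (rational_pairs A e).

Lemma zero_in_rational_pairs k v : (0, 0) \in R k v.
Proof. by rewrite inE /= !(linear0, mulmx0). Qed.

(** The count is by pairs: for b nonzero, b(A) is invertible and (a, b) determines v; for b = 0 the
    relation forces a = 0, and (0, 0) belongs to every v. *)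
Lemma sum_card_rational_pairs k : (k <= N.+1)%N ->
  (\sum_v #|R k v| = q ^ N.+1 + (q ^ k).-1 * q ^ k)%N.
Proof.
move=> le_kN; have sz (a : 'rV[F]_k) := leq_trans (size_rVpoly a) le_kN.
have card_v (ab : 'rV[F]_k * 'rV[F]_k) :
    (\sum_v (ab \in R k v) =
      if ab.2 == 0%R then if ab.1 == 0%R then q ^ N.+1 else 0 else 1)%N.
  case: ab => a b /=; have [-> | nz_b] := eqVneq b 0; last first.
    have Ub: horner_mx A (rVpoly b) \in unitmx.
      by rewrite horner_mx_unit ?char_poly_ndvd ?rVpoly_eq0.
    rewrite (bigD1 (e *m horner_mx A (rVpoly a) *m invmx (horner_mx A (rVpoly b)))) //=.
    rewrite inE mulmxKV // eqxx big1 ?addn0 // => v ne_v; rewrite inE.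
    by case: eqP => //= eab; rewrite eab mulmxK ?eqxx in ne_v.
  have Ra v : ((a, 0) \in R k v) = (a == 0).
    rewrite inE /= linear0 rmorph0 mulmx0 -(rVpoly_eq0 a).
    by apply/eqP/eqP => [/mul_horner_mx_inj0-> // | ->]; rewrite rmorph0 mulmx0.
  under eq_bigr => v _ do rewrite Ra; rewrite sum_nat_const.
  have ->: #|{: 'rV[F]_N.+1}| = (q ^ N.+1)%N by rewrite card_mx mul1n.
  by case: (a == 0); rewrite ?muln1 ?muln0.
have ->: (\sum_v #|R k v| = \sum_v \sum_ab (ab \in R k v))%N.
  by apply: eq_bigr => v _; rewrite -sum1_card big_mkcond /=.
rewrite exchange_big /=; under eq_bigr => ab _ do rewrite card_v.
rewrite -(pair_bigA _ (fun a b => if b == 0 then if a == 0 then (q ^ N.+1)%N else 0%N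
  else 1%N)) /=.
rewrite exchange_big /= (bigD1 0) //= eqxx; congr (_ + _)%N.
  by rewrite (bigD1 0) //= eqxx big1 ?addn0 // => a /negPf->.
have ck : #|{: 'rV[F]_k}| = (q ^ k)%N by rewrite card_mx mul1n.
rewrite (eq_bigr (fun _ => (q ^ k)%N)); last first.
  by move=> b /negPf->; rewrite sum_nat_const muln1 ck.
by rewrite sum_nat_const cardC1 ck.
Qed.

(** Two fractions for the same v agree modulo [char_poly A]. The bound on [k] keeps both products
    below the degree of [char_poly A], so the congruence is an equality. *)
Lemma rational_pairs_cross k v (ab ab' : 'rV[F]_k * 'rV[F]_k) :
  (k.*2 <= N.+2)%N -> ab \in R k v -> ab' \in R k v ->
  rVpoly ab.1 * rVpoly ab'.2 = rVpoly ab'.1 * rVpoly ab.2.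
Proof.
case: ab ab' => [a b] [a' b'] /= le_kN; rewrite !inE /= => /eqP Rab /eqP Rab'.
have szM (x y : 'rV[F]_k) : (size (rVpoly x * rVpoly y)%R <= N.+1)%N.
  rewrite (leq_trans (size_polyMleq _ _)) // -subn1 leq_subLR add1n.
  by rewrite (leq_trans _ le_kN) // -addnn leq_add ?size_rVpoly.
apply/eqP; rewrite -subr_eq0; apply/eqP.
apply: (mul_horner_mx_inj0 irrA nz_e).
  by rewrite (leq_trans (size_polyD _ _)) // size_polyN geq_max !szM.
have hM p r : horner_mx A (p * r) = horner_mx A p *m horner_mx A r by rewrite rmorphM.
by rewrite rmorphB mulmxBr /= !hM !mulmxA Rab Rab' -!mulmxA -!hM mulrC subrr.
Qed.

Lemma rational_pairs_scaleX k v (a b : {poly F}) j :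
  (size ('X^j * a)%R <= k)%N -> (size ('X^j * b)%R <= k)%N ->
  e *m horner_mx A a = v *m horner_mx A b ->
  (poly_rV ('X^j * a), poly_rV ('X^j * b)) \in R k v.
Proof.
move=> sa sb eab; rewrite inE /= !poly_rV_K //.
by rewrite !['X^j * _]mulrC !rmorphM /= -!mulmxE !mulmxA eab.
Qed.

(** A nonzero pair can be multiplied by a power of X, which preserves the relation, until the larger
    of its two degrees is exactly [k]. *)
Lemma rational_pairs_top k v : R k.+1 v != [set (0, 0)] ->
  exists2 ab, ab \in R k.+1 v & (rVpoly ab.1)`_k != 0 \/ (rVpoly ab.2)`_k != 0.
Proof.
move=> nontriv.
have /subsetPn[[a b] Rab nz_ab] : ~~ (R k.+1 v \subset [set (0, 0)]).
  by apply: contra nontriv => sR; rewrite eqEsubset sR sub1set zero_in_rational_pairs.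
move: Rab nz_ab; rewrite !inE /= => /eqP eab nz_ab.
pose s := maxn (size (rVpoly a)) (size (rVpoly b)).
have le_sk : (s <= k.+1)%N by rewrite geq_max !size_rVpoly.
have szX (p : {poly F}) : (size p <= s)%N -> (size ('X^(k.+1 - s) * p)%R <= k.+1)%N.
  have [-> | nz_p] := eqVneq p 0; first by rewrite mulr0 size_poly0.
  by move=> le_ps; rewrite mulrC size_mulXn // -[X in (_ <= X)%N](subnK le_sk) leq_add2l.
have topX (p : {poly F}) : p != 0 -> size p = s -> ('X^(k.+1 - s) * p)`_k != 0.
  move=> nz_p sz_p; rewrite coefXnM.
  have s_gt0 : (0 < s)%N by rewrite -sz_p size_poly_gt0.
  have -> : (k < k.+1 - s)%N = false by lia.
  have -> : (k - (k.+1 - s) = s.-1)%N by lia.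
  by rewrite -sz_p -lead_coefE lead_coef_eq0.
exists (poly_rV ('X^(k.+1 - s) * rVpoly a), poly_rV ('X^(k.+1 - s) * rVpoly b)).
  by apply: rational_pairs_scaleX => //; apply: szX; rewrite leq_max leqnn ?orbT.
rewrite /= !poly_rV_K ?szX ?leq_max ?leqnn ?orbT //.
have [le_ab | lt_ba] := leqP (size (rVpoly a)) (size (rVpoly b)).
  right; apply: topX; last by rewrite /s (maxn_idPr le_ab).
  apply: contraNneq nz_ab => b0; rewrite b0 size_poly0 leqn0 size_poly_eq0 in le_ab.
  by rewrite xpair_eqE -!rVpoly_eq0 le_ab b0 eqxx.
left; apply: topX; last by rewrite /s (maxn_idPl (ltnW lt_ba)).
by rewrite -size_poly_gt0 (leq_trans _ lt_ba).
Qed.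

(** Fix a pair (a0, b0) with a nonzero coefficient in degree [k]. Every pair of [R k.+1 v] is then
    uniquely a scalar multiple of it plus a pair of [R k v]. *)
Lemma card_rational_pairsS k v : (k.*2 <= N)%N -> R k.+1 v != [set (0, 0)] ->
  #|R k.+1 v| = (q * #|R k v|)%N.
Proof.
move=> le_kN /rational_pairs_top[[a0 b0] R0 /= top0].
have sz (a : 'rV[F]_k) : (size (rVpoly a) <= k.+1)%N by rewrite leqW ?size_rVpoly.
pose w (a : 'rV[F]_k) : 'rV[F]_k.+1 := poly_rV (rVpoly a).
have wK a : rVpoly (w a) = rVpoly a by rewrite poly_rV_K.
have w_top (a : 'rV[F]_k) : (rVpoly a)`_k = 0 by rewrite nth_default ?size_rVpoly.
(* [g] is the claimed bijection from F times [R k v] onto [R k.+1 v]. *)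
pose g (x : F * ('rV[F]_k * 'rV[F]_k)) :=
  (x.1 *: a0 + w x.2.1, x.1 *: b0 + w x.2.2).
have g_inj : injective g.
  move=> [c [a b]] [c' [a' b']] [].
  move=> /(congr1 rVpoly); rewrite !linearD !linearZ /= !wK => Ea.
  move=> /(congr1 rVpoly); rewrite !linearD !linearZ /= !wK => Eb.
  have Ec : c = c'.
    by case: top0 => top0; apply: (mulIf top0);
      [move/polyP/(_ k): Ea | move/polyP/(_ k): Eb];
      rewrite !coefD !coefZ !w_top !addr0.
  rewrite Ec in Ea Eb *.
  by move/addrI/(can_inj rVpolyK): Ea => ->; move/addrI/(can_inj rVpolyK): Eb => ->.
rewrite -cardsT -cardsX -(card_imset _ g_inj); congr #|pred_of_set _|.
apply/setP => -[a b]; apply/idP/imsetP => [Rab | [[c [a' b']]]]; last first.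
  rewrite !inE /= => /eqP Rab' [-> ->].
  rewrite !(linearD, linearZ) /= !wK ?(linearD, linearZ) /= ?mulmxDr -?scalemxAr Rab'.
  by move: R0; rewrite inE /= => /eqP->.
have cross := rational_pairs_cross (k := k.+1) le_kN Rab R0.
(* Comparing coefficients in degree 2k shows that the top coefficients of (a, b) are proportional to
   those of (a0, b0); subtracting the right multiple lowers both degrees. *)
have {}cross : (rVpoly a)`_k * (rVpoly b0)`_k = (rVpoly a0)`_k * (rVpoly b)`_k.
  by move/polyP/(_ (k + k)%N): cross; rewrite !coefM_top ?size_rVpoly.
have [c Ea Eb] : exists2 c, (rVpoly a)`_k = c * (rVpoly a0)`_k
                          & (rVpoly b)`_k = c * (rVpoly b0)`_k.
  case: top0 => top0.
    exists ((rVpoly a)`_k / (rVpoly a0)`_k); first by rewrite divfK.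
    by rewrite mulrAC cross mulrAC mulfV ?mul1r.
  exists ((rVpoly b)`_k / (rVpoly b0)`_k); last by rewrite divfK.
  by rewrite mulrAC [(rVpoly b)`_k * _]mulrC -cross mulfK.
have low (x x0 : 'rV[F]_k.+1) : (rVpoly x)`_k = c * (rVpoly x0)`_k ->
    (size (rVpoly (x - c *: x0)) <= k)%N.
  move=> Ex; apply/leq_sizeP => j; rewrite leq_eqVlt => /orP[/eqP<- | lt_kj].
    by rewrite linearB linearZ coefB coefZ Ex subrr.
  by rewrite nth_default // (leq_trans (size_rVpoly _)).
exists (c, (poly_rV (rVpoly (a - c *: a0)), poly_rV (rVpoly (b - c *: b0)))).
  move: Rab R0; rewrite !inE /= !poly_rV_K ?low // => /eqP Rab /eqP R0.
  have hB x (y x0 : 'rV[F]_k.+1) : x *m horner_mx A (rVpoly (y - c *: x0))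
      = x *m horner_mx A (rVpoly y) - c *: (x *m horner_mx A (rVpoly x0)).
    by rewrite [rVpoly _]linearB linearZ /= rmorphB /= horner_mxZ mulmxBr -scalemxAr.
  by rewrite !hB Rab R0.
by rewrite /g /w /= !poly_rV_K ?low // !rVpolyK ![_ *: _ + _]addrC !subrK.
Qed.

(** The sum of [#|R k.+1 v|] and q times the sum of [#|R k v|] have equal terms except at the
    vectors counted here, where the terms are 1 and q. Both sums being known, the number of such
    vectors follows. *)
Lemma card_rational_pairs_trivial k : (k.*2 <= N)%N ->
  #|[set v | R k.+1 v == [set (0, 0)]]| = (q ^ N.+1 - q ^ k.*2.+1)%N.
Proof.
move=> le_kN; set G := [set v | _].
have q_gt1 : (1 < q)%N := finNzRing_gt1 F.
have q_gt0 := ltnW q_gt1.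
have le_k : (k <= N)%N by rewrite (leq_trans _ le_kN) // -addnn leq_addr.
have := sum_card_rational_pairs (k := k.+1) le_k.
have := sum_card_rational_pairs (k := k) (leqW le_k).
move=> /(congr1 (muln q)); rewrite big_distrr /= => S0 S1.
have : (\sum_v #|R k.+1 v| + #|G| * q.-1 = \sum_v q * #|R k v|)%N.
  have -> : (#|G| * q.-1 = \sum_v if v \in G then q.-1 else 0)%N.
    by rewrite -big_mkcond sum_nat_const.
  rewrite -big_split /=; apply: eq_bigr => v _; rewrite inE.
  have [E | nt] := eqVneq; last by rewrite addn0 card_rational_pairsS.
  (* Raising the degree bound embeds [R k v] into [R k.+1 v], so it is trivial as well. *)
  have -> : R k v = [set (0, 0)].
    apply/setP => -[a b]; apply/idP/set1P => [Rab | [-> ->]]; last first.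
      exact: zero_in_rational_pairs.
    have : (poly_rV (rVpoly a), poly_rV (rVpoly b)) \in R k.+1 v.
      by move: Rab; rewrite !inE /= !poly_rV_K // leqW ?size_rVpoly.
    rewrite E => /set1P[/(congr1 rVpoly) Ea /(congr1 rVpoly) Eb].
    rewrite !poly_rV_K ?leqW ?size_rVpoly // !linear0 in Ea Eb.
    by congr pair; apply/eqP; rewrite -rVpoly_eq0 ?Ea ?Eb.
  by rewrite E !cards1 muln1 add1n prednK.
rewrite {}S1 {}S0 {le_kN le_k} -addnn !expnS expnD -[(q * q ^ N)%N]expnS.
have : (0 < q ^ k)%N by rewrite expn_gt0 q_gt0.
(* The powers of q become variables; a polynomial identity remains, with common factor [r.+1], which
   is q - 1. *)
move: q_gt1 {q_gt0} (q ^ N.+1)%N (q ^ k)%N #|G|; case: q => [|[|r]] // _ Q [|P] // g _.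
rewrite /= => E; have {}E : ((g + r.+2 * (P.+1 * P.+1)) * r.+1 = Q * r.+1)%N by nia.
move/eqP: E; rewrite eqn_pmul2r // => /eqP <-.
by rewrite addnK.
Qed.

End RationalPairs.

(** * Cyclic vectors and intertwining matrices *)

(** The vectors e, e S, ..., e S^N form a basis: a linear relation among them is a polynomial of
    degree at most N in S that kills e, hence zero. *)
Lemma cyclic_vector (F : fieldType) N (S : 'M[F]_N.+1) (e : 'rV_N.+1) :
  irreducible_poly (char_poly S) -> e != 0 ->
  forall u : 'rV_N.+1, exists p, u = e *m horner_mx S p.
Proof.
move=> irrS nz_e u.
pose B := \matrix_(i < N.+1) (e *m S ^+ i).
have BE (w : 'rV_N.+1) : w *m B = e *m horner_mx S (rVpoly w).
  rewrite mulmx_sum_row horner_rVpoly [X in vec_mx X]mulmx_sum_row !linear_sum /=.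
  by apply: eq_bigr => i _; rewrite linearZ /= !rowK mxvecK scalemxAr.
have UB : B \in unitmx.
  rewrite -row_free_unit -kermx_eq0; apply/eqP/row_matrixP => i; rewrite row0.
  have: row i (kermx B) *m B = 0 by rewrite -row_mul mulmx_ker row0.
  rewrite BE => /(mul_horner_mx_inj0 irrS nz_e) E; have {}E := E (size_poly _ _).
  by rewrite -[LHS]rVpolyK E linear0.
by exists (rVpoly (u *m invmx B)); rewrite -BE mulmxKV.
Qed.

(** [M] is to send e0 p(S) to e p(A). This is well defined because e0 p(S) = 0 only if the common
    characteristic polynomial divides p. *)
Lemma intertwiner_exists (F : fieldType) N (A S : 'M[F]_N.+1) (e e0 : 'rV_N.+1) :
  irreducible_poly (char_poly S) -> char_poly S = char_poly A -> e0 != 0 ->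
  exists2 M, S *m M = M *m A & e0 *m M = e.
Proof.
move=> irrS EAS nz_e0.
have ex_p i : exists p, delta_mx 0 i == e0 *m horner_mx S p.
  by have [p ->] := cyclic_vector irrS nz_e0 (delta_mx 0 i); exists p.
pose P i := xchoose (ex_p i); pose M := \matrix_i (e *m horner_mx A (P i)).
have PE i : delta_mx 0 i = e0 *m horner_mx S (P i) by apply/eqP/(xchooseP (ex_p i)).
(* [r] is another polynomial with e0 r(S) = e0 p(S), built from the coordinates; the characteristic
   polynomial therefore divides [r - p]. *)
have ME p : e0 *m horner_mx S p *m M = e *m horner_mx A p.
  set w := e0 *m _; pose r := \sum_i w 0 i *: P i.
  have -> : w *m M = e *m horner_mx A r.
    rewrite mulmx_sum_row linear_sum linear_sum /=; apply: eq_bigr => i _.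
    by rewrite rowK linearZ /= -scalemxAr.
  apply/eqP; rewrite -subr_eq0 -mulmxBr -rmorphB /=.
  have : char_poly S %| r - p.
    rewrite -(mul_horner_mx_eq0 _ irrS nz_e0) rmorphB mulmxBr subr_eq0 /=.
    apply/eqP; rewrite -/w [RHS]row_sum_delta linear_sum linear_sum /=.
    by apply: eq_bigr => i _; rewrite linearZ /= -scalemxAr -PE.
  case/dvdpP=> t ->; rewrite EAS rmorphM /= Cayley_Hamilton mulr0 mulmx0 //.
exists M; last by have := ME 1; rewrite !rmorph1 !mulmx1.
apply/row_matrixP => i; rewrite !row_mul.
have [p Ep] := cyclic_vector irrS nz_e0 (delta_mx 0 i).
rewrite !rowE Ep ME -mulmxA.
have := ME (p * 'X); rewrite !rmorphM /= !horner_mx_X -!mulmxE !mulmxA => <-.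
by rewrite -!mulmxA.
Qed.

Lemma intertwiner_unique (F : fieldType) N (A S M M' : 'M[F]_N.+1) (e0 : 'rV_N.+1) :
  irreducible_poly (char_poly S) -> e0 != 0 ->
  S *m M = M *m A -> S *m M' = M' *m A -> e0 *m M = e0 *m M' -> M = M'.
Proof.
move=> irrS nz_e0 SM SM' E; apply/row_matrixP => i; rewrite !rowE.
have [p ->] := cyclic_vector irrS nz_e0 (delta_mx 0 i).
by rewrite -!mulmxA !(horner_mx_intertwine _ SM, horner_mx_intertwine _ SM') !mulmxA E.
Qed.

(** The left kernel of [M] is stable under [S], and any nonzero vector in it would be cyclic for
    [S], which would make [M] zero. *)
Lemma intertwiner_unit (F : fieldType) N (A S M : 'M[F]_N.+1) :
  irreducible_poly (char_poly S) -> irreducible_poly (char_poly A) ->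
  M != 0 -> S *m M = M *m A -> M \in unitmx.
Proof.
move=> irrS irrA nz_M SM; rewrite -row_free_unit -kermx_eq0.
apply: contraNT nz_M => /rowV0Pn[u /sub_kermxP uM nz_u]; apply/eqP/row_matrixP => i.
rewrite rowE row0; have [p ->] := cyclic_vector irrS nz_u (delta_mx 0 i).
by rewrite -mulmxA (horner_mx_intertwine _ SM) mulmxA uM mul0mx.
Qed.

Lemma char_poly_similar (F : fieldType) N (A S M : 'M[F]_N.+1) :
  M \in unitmx -> S *m M = M *m A -> char_poly S = char_poly A.
Proof.
move=> UM SM; pose M' := map_mx polyC M.
have E : char_poly_mx S *m M' = M' *m char_poly_mx A.
  rewrite /char_poly_mx mulmxBl mulmxBr scalar_mxC; congr (_ - _).
  by rewrite /M' -!map_mxM SM.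
have nz : \det M' != 0 by rewrite det_map_mx polyC_eq0 -unitfE -unitmxE.
by apply: (mulIf nz); rewrite [RHS]mulrC /char_poly -!det_mulmx E.
Qed.

(** * Transposed block companion matrices as matrices of A in bases e0 A^i, v A^i *)

Section BlockCompanionCount.

Variables (F : finFieldType) (N k : nat).
Variables (idx : 'I_k.+1 * 'I_2 -> 'I_N.+1) (idxV : 'I_N.+1 -> 'I_k.+1 * 'I_2).
Hypotheses (idxK : cancel idx idxV) (idxVK : cancel idxV idx).
Variables (A : 'M[F]_N.+1).
Hypotheses (irrA : irreducible_poly (char_poly A)).

(* The transpose of a block companion matrix shifts the blocks of row vectors
   e_(i, a) |-> e_(i + 1, a), except for the last one. *)
Definition block_shift (S : 'M[F]_N.+1) : bool :=
  [forall i : 'I_k.+1, forall a : 'I_2,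
    (i < k)%N ==> (row (idx (i, a)) S == delta_mx 0 (idx (inord i.+1, a)))].

(** The rows of [K v] are the vectors e0 A^i and v A^i for i at most [k], arranged by [idx]: the
    candidate basis in which [A] becomes a block shift. *)
Let e0 : 'rV[F]_N.+1 := delta_mx 0 (idx (ord0, ord0)).
Let gen (v : 'rV[F]_N.+1) (a : 'I_2) := if a == ord0 then e0 else v.
Let K v := \matrix_(j < N.+1) (gen v (idxV j).2 *m A ^+ (idxV j).1).

Let nz_e0 : e0 != 0.
Proof.
apply/eqP => /rowP/(_ (idx (ord0, ord0))) /eqP.
by rewrite !mxE !eqxx oner_eq0.
Qed.

Let row_K v i a : row (idx (i, a)) (K v) = gen v a *m A ^+ i.
Proof. by rewrite rowK idxK. Qed.

(** This turns linear relations among the rows of [K v] into relations between two polynomials of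
    degree at most [k]. *)
Let mul_K v (u : 'rV[F]_N.+1) :
  u *m K v = e0 *m horner_mx A (rVpoly (\row_i u 0 (idx (i, ord0))))
           + v *m horner_mx A (rVpoly (\row_i u 0 (idx (i, ord_max)))).
Proof.
have HE (x : 'rV[F]_N.+1) (w : 'rV[F]_k.+1) :
    x *m horner_mx A (rVpoly w) = \sum_i w 0 i *: (x *m A ^+ i).
  rewrite horner_rVpoly [X in vec_mx X]mulmx_sum_row !linear_sum /=.
  by apply: eq_bigr => i _; rewrite linearZ /= !rowK mxvecK scalemxAr.
rewrite !HE mulmx_sum_row (reindex idx) /=; last by exists idxV => x _.
rewrite (eq_bigr (fun x => u 0 (idx (x.1, x.2)) *: row (idx (x.1, x.2)) (K v))); last by case.
rewrite -(pair_bigA _ (fun i a => u 0 (idx (i, a)) *: row (idx (i, a)) (K v))) /=.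
rewrite -big_split /=; apply: eq_bigr => i _.
by rewrite big_ord_recr big_ord1 /= !row_K !mxE; congr (_ *: _ + _ *: _);
  do ?congr (u 0 (idx (i, _))); apply: val_inj.
Qed.

Let mulN (v : 'rV[F]_N.+1) (b : 'rV[F]_k.+1) :
  v *m horner_mx A (rVpoly (- b)) = - (v *m horner_mx A (rVpoly b)).
Proof. by rewrite [rVpoly _]linearN rmorphN mulmxN. Qed.

(** A row vector killed by [K v], with coordinates split into a and b, is the same as the pair (a,
    -b) in [rational_pairs]. *)
Let unit_K v : (K v \in unitmx) = (rational_pairs A e0 k.+1 v == [set (0, 0)]).
Proof.
rewrite -row_free_unit -kermx_eq0; apply/idP/idP => [/eqP ker0 | /eqP R0].
  rewrite eqEsubset sub1set zero_in_rational_pairs andbT.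
  apply/subsetP => -[a b]; rewrite !inE /= => /eqP Rab.
  pose u := \row_j (if (idxV j).2 == ord0 then a 0 (idxV j).1 else - b 0 (idxV j).1).
  have Ea : \row_i u 0 (idx (i, ord0)) = a.
    by apply/rowP => i; rewrite !mxE idxK.
  have Eb : \row_i u 0 (idx (i, ord_max)) = - b.
    by apply/rowP => i; rewrite !mxE idxK.
  have u0 : u = 0.
    apply/eqP; rewrite -submx0 -ker0; apply/sub_kermxP.
    by rewrite mul_K Ea Eb Rab mulN addrN.
  have {}Ea : a = 0 by rewrite -Ea u0; apply/rowP => i; rewrite !mxE.
  have {}Eb : b = 0 by rewrite -[b]opprK -Eb u0; apply/rowP => i; rewrite !mxE oppr0.
  by rewrite Ea Eb.
apply: contraT => /rowV0Pn[u /sub_kermxP]; rewrite mul_K => uK /eqP[].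
set a := \row_i _ in uK; set b := \row_i _ in uK.
have : (a, - b) \in rational_pairs A e0 k.+1 v.
  by rewrite inE /= mulN -addr_eq0 uK.
rewrite R0 => /set1P[a0 /eqP]; rewrite oppr_eq0 => /eqP b0.
apply/rowP => j; rewrite mxE -(idxVK j); case: (idxV j) => i c.
have [-> | ->] : c = ord0 \/ c = ord_max.
  by case: c => -[|[|//]] ?; [left | right]; apply: val_inj.
  by move/rowP/(_ i): a0; rewrite !mxE.
by move/rowP/(_ i): b0; rewrite !mxE.
Qed.

Let conjK v := K v *m A *m invmx (K v).

Let e0K v : e0 *m K v = e0.
Proof. by rewrite -rowE row_K expr0 mulmx1. Qed.

Let conjK_intertwine v : K v \in unitmx -> conjK v *m K v = K v *m A.
Proof. by move=> UK; rewrite mulmxKV. Qed.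

(** The bijection is [conjK]. It is injective because [K v] is the only intertwiner from [conjK v]
    to [A] that fixes [e0], and v is one of its rows; it is surjective because an intertwiner fixing
    [e0] exists for each [S] and has the form [K v]. *)
Lemma card_block_shift :
  #|[set S | block_shift S & char_poly S == char_poly A]|
    = #|[set v | rational_pairs A e0 k.+1 v == [set (0, 0)]]|.
Proof.
rewrite -(card_in_imset (f := conjK)) => [|v w]; last first.
  rewrite !inE -!unit_K => Uv Uw E.
  have EKs : K v = K w.
    have chA := char_poly_similar Uv (conjK_intertwine Uv).
    apply: (intertwiner_unique (S := conjK v) (A := A) (e0 := e0)) => //.
    - by rewrite chA.
    - exact: conjK_intertwine.
    - by rewrite E conjK_intertwine.
    - by rewrite !e0K.
  have gE x : row (idx (ord0, ord_max)) (K x) = x by rewrite row_K expr0 mulmx1.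
  by rewrite -(gE v) -(gE w) EKs.
congr #|pred_of_set _|; apply/setP => S; apply/idP/imsetP => [|[v]].
  rewrite inE => /andP[/forallP bS /eqP EAS].
  have irrS : irreducible_poly (char_poly S) by rewrite EAS.
  (* Requiring e0 M = e0 fixes the freedom of multiplying [M] by an invertible element of F[A]. *)
  have [M SM e0M] := intertwiner_exists e0 irrS EAS nz_e0.
  have nz_M : M != 0 by apply: contraNneq nz_e0 => M0; rewrite -e0M M0 mulmx0.
  have UM := intertwiner_unit irrS irrA nz_M SM.
  pose v := row (idx (ord0, ord_max)) M; have KM : K v = M.
    apply/row_matrixP => j; rewrite -(idxVK j); case: (idxV j) => -[i lt_i] a.
    rewrite row_K /=.
    (* Induction on the block: the shift property of [S] makes row (i + 1, a) of [M] the product of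
       row (i, a) of [M] with [A]. *)
    elim: i lt_i => [|i IH] lt_i.
      rewrite expr0 mulmx1 /gen; case: eqP => [-> | ne_a].
        rewrite -[LHS]e0M -rowE; congr (row (idx (_, _)) M); exact: val_inj.
      rewrite /v; congr (row (idx (_, _)) M); apply: val_inj => //=.
      by case: a ne_a => -[|[|//]] //= ? [] ; apply: val_inj.
    have lt_i' := ltnW lt_i; have := IH lt_i'.
    rewrite exprSr -mulmxE mulmxA => ->.
    rewrite !rowE -!mulmxA -SM mulmxA -rowE.
    have /forallP/(_ a)/implyP/(_ lt_i)/eqP -> := bS (Ordinal lt_i').
    by congr (delta_mx 0 (idx (_, a)) *m M); apply: val_inj; rewrite /= inordK.
  exists v; first by rewrite inE -unit_K KM.
  by rewrite /conjK KM -SM mulmxK.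
rewrite inE -unit_K => Uv ->; rewrite inE.
rewrite (char_poly_similar Uv (conjK_intertwine Uv)) eqxx andbT.
apply/forallP => i; apply/forallP => a; apply/implyP => lt_ik.
rewrite /conjK !row_mul row_K -[_ *m A]mulmxA mulmxE -exprSr.
have -> : gen v a *m A ^+ i.+1 = row (idx (inord i.+1, a)) (K v).
  by rewrite row_K inordK.
by rewrite -row_mul mulmxV // row1.
Qed.

End BlockCompanionCount.

(** * Block companion matrices with a given irreducible characteristic polynomial *)

Lemma char_poly_tr (R : comNzRingType) n (A : 'M[R]_n) : char_poly A^T = char_poly A.
Proof.
rewrite -[RHS]det_tr; congr (\det _); apply/matrixP => i j.
by rewrite !mxE eq_sym.
Qed.

Lemma mxvec_index_bij m n :
  bijective (fun x : 'I_m * 'I_n => mxvec_index x.1 x.2).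
Proof.
have [g gK Kg] := curry_mxvec_bij m n; exists g => [[i a] | x].
  exact: (gK (i, a)).
by have := Kg x isT; case: (g x).
Qed.

Lemma char_poly_surj (R : comNzRingType) N (f : {poly R}) :
  f \is monic -> size f = N.+1 -> exists A : 'M[R]_N, char_poly A = f.
Proof.
move=> mon_f sz_f; have := companionmxK mon_f.
by move: (companionmx f); rewrite sz_f => A EA; exists A.
Qed.

(** Transposition turns the prescribed block columns into prescribed rows, the form suited to
    matrices acting on row vectors. The dimension [k.+1 * 2] computes to [(k * 2).+2]. *)
Lemma block_companion_tr (F : finFieldType) k (T : 'M[F]_(k.+1 * 2)) :
  block_companion T
    = block_shift (N := (k * 2).+1) (fun x => mxvec_index x.1 x.2) T^T.
Proof.
have idx_eq (i j : 'I_k.+1) (a b : 'I_2) :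
    (mxvec_index i a == mxvec_index j b) = (i == j) && (a == b).
  by rewrite (inj_eq (bij_inj (mxvec_index_bij k.+1 2)) (i, a) (j, b)).
have entry (i j : 'I_k.+1) (a b : 'I_2) : (j < k)%N ->
    (delta_mx 0 (mxvec_index (inord j.+1 : 'I_k.+1) b) : 'rV[F]_(k.+1 * 2))
       0 (mxvec_index i a)
    = (if i == j.+1 :> nat then 1%:M else 0 : 'M[F]_2) a b.
  move=> lt_jk; rewrite mxE eqxx idx_eq -val_eqE /= inordK //.
  by case: (_ == _ :> nat); rewrite !mxE.
apply/forallP/forallP => bT i; apply/forallP => j; apply/implyP => lt_k.
  apply/eqP/rowP => x.
  have [l [a ->]] : exists l a, x = @mxvec_index k.+1 2 l a.
    by case/mxvec_indexP: (x : 'I_(k.+1 * 2)) => l a; exists l, a.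
  have /forallP/(_ i)/implyP/(_ lt_k)/eqP/matrixP/(_ a j) := bT l.
  by rewrite !mxE => ->; rewrite -entry // mxE.
apply/eqP/matrixP => a b.
have /forallP/(_ b)/implyP/(_ lt_k)/eqP/rowP/(_ (mxvec_index i a)) := bT j.
by rewrite -entry // !mxE /= => ->.
Qed.

(** In dimension 2k + 2 there are q^(2k+2) - q^(2k+1) admissible vectors v, and transposition
    carries block shifts back to block companion matrices. *)
Lemma card_block_companion_char_poly (F : finFieldType) k (f : {poly F}) :
  f \is monic -> irreducible_poly f -> size f = (2 * k.+1).+1 ->
  #|[set T : 'M[F]_(k.+1 * 2) | block_companion T & char_poly T == f]|
    = (#|F| ^ (2 * k.+1 - 1) * (#|F| - 1))%N.
Proof.
move=> mon_f irr_f sz_f; rewrite mulnC in sz_f.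
have [A EA] : exists A : 'M[F]_((k * 2).+2), char_poly A = f by apply: char_poly_surj.
have irrA : irreducible_poly (char_poly A) by rewrite EA.
have [idxV idxK idxVK] := mxvec_index_bij k.+1 2.
have := card_block_shift (N := (k * 2).+1) idxK idxVK irrA.
rewrite card_rational_pairs_trivial //; last 2 first.
- apply/eqP => /rowP/(_ (mxvec_index (ord0 : 'I_k.+1) (ord0 : 'I_2))) /eqP.
  by rewrite !mxE !eqxx oner_eq0.
- by lia.
move=> cardS; rewrite -(card_imset _ (@trmx_inj F (k.+1 * 2) (k.+1 * 2))).
transitivity (#|F| ^ (k * 2).+2 - #|F| ^ (k.*2).+1)%N; last first.
  have -> : (2 * k.+1 - 1 = k.*2.+1)%N by lia.
  by rewrite muln2 expnSr mulnBr muln1.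
rewrite -cardS; congr #|pred_of_set _|; apply/setP => S.
rewrite inE EA; apply/imsetP/idP => [[T] | /andP[bS ES]].
  by rewrite inE block_companion_tr => /andP[bT ET] ->; rewrite bT char_poly_tr.
by exists S^T; rewrite ?trmxK // inE block_companion_tr trmxK bS char_poly_tr.
Qed.

(** * Finite extensions, minimal polynomials and roots *)

Lemma card_finvect (F : finFieldType) (V : vectType F) :
  #|finvect_type V| = (#|F| ^ \dim {:V})%N.
Proof.
rewrite dimvf -[dim V]mul1n -card_mx.
by apply: (bij_eq_card (f := (VectorInternalTheory.v2r : finvect_type V -> _)));
  exists VectorInternalTheory.r2v;
  [apply: VectorInternalTheory.v2rK | apply: VectorInternalTheory.r2vK].
Qed.

Lemma natr_card_finField (F : finFieldType) : #|F|%:R = 0 :> F.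
Proof. by rewrite -FinRing.zmodXgE -cardsT expg_cardG ?inE. Qed.

(** L is a splitting field of X^m - X with m = q^N. The roots are the fixed points of the N-th power
    of Frobenius, hence form a subfield and fill L; they are distinct, so L has m elements. *)
Lemma finField_ext_exists (F : finFieldType) N : (0 < N)%N ->
  exists L : fieldExtType F, \dim {:L} = N.
Proof.
move=> N_gt0; set m := (#|F| ^ N)%N.
have q_gt1 : (1 < #|F|)%N := finNzRing_gt1 F.
have m_gt1 : (1 < m)%N by rewrite -(expn0 #|F|) ltn_exp2l.
have sz_p (R : nzRingType) : size ('X^m - 'X : {poly R}) = m.+1.
  by rewrite size_polyDl size_polyXn // size_polyN size_polyX.
have nz_p : 'X^m - 'X != 0 :> {poly F} by rewrite -size_poly_gt0 sz_p.
have [L [zs]] := FinSplittingFieldFor nz_p.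
rewrite [map_poly _ _]rmorphB rmorphXn /= map_polyX => Dp defL.
exists L.
have m0 : m%:R = 0 :> L.
  by rewrite /m natrX -(rmorph_nat (in_alg L)) natr_card_finField rmorph0 expr0n gtn_eqF.
(* Since m = 0 in L, the derivative of X^m - X is the constant -1. *)
have Uzs : uniq zs.
  rewrite -separable_prod_XsubC -(eqp_separable Dp) unlock.
  rewrite derivB derivXn derivX -mulr_natr -polyC_natr m0 mulr0 sub0r.
  by rewrite -[X in coprimep _ X]scaleN1r coprimepZr ?coprimep1 // oppr_eq0 oner_eq0.
have [/= a _] := finField_galois_generator (sub1v {:L}).
rewrite dimv1 expn1 => Da.
have aX i x : (a ^+ i)%g x = x ^+ (#|F| ^ i).
  elim: i x => [|i IHi] x; first by rewrite gal_id.
  by rewrite expgSr galM ?memvf // IHi Da ?memvf // expnSr exprM.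
have fixL : (<<1 & zs>> <= fixedField [set (a ^+ N)%g])%VS.
  apply/Fadjoin_seqP; split; first exact: sub1v.
  move=> z zs_z; apply/fixedFieldP; rewrite ?memvf // => _ /set1P ->.
  have : root ('X^m - 'X) z by rewrite (eqp_root Dp) root_prod_XsubC.
  by rewrite rootE !hornerE subr_eq0 aX => /eqP.
have in_zs (x : finvect_type L) : x \in (zs : seq (finvect_type L)).
  rewrite -root_prod_XsubC -(eqp_root Dp) rootE !hornerE subr_eq0 -aX.
  have : x \in fixedField [set (a ^+ N)%g] by apply: (subvP fixL); rewrite defL memvf.
  by move/fixedFieldP => ->; rewrite ?memvf ?set11.
have : #|finvect_type L| = m.
  transitivity #|(zs : seq (finvect_type L))|.
    by apply: eq_card => x; rewrite in_zs.
  apply: succn_inj; rewrite (card_uniqP _) //= -(size_prod_XsubC _ id).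
  by rewrite -(eqp_size Dp) sz_p.
rewrite card_finvect.
by move/eqP; rewrite eqn_exp2l // => /eqP.
Qed.

(** If [f] does not divide [p], a Bezout relation between them evaluated at a common root would give
    0 = 1. *)
Lemma irreducible_root_dvdp (F L : fieldType) (iota : {rmorphism F -> L})
    (f p : {poly F}) x :
  irreducible_poly f -> root (map_poly iota f) x ->
  root (map_poly iota p) x = (f %| p).
Proof.
move=> irr_f fx; apply/idP/idP => [px | /dvdpP[r ->]]; last first.
  by rewrite rmorphM rootM fx orbT.
apply: contraTT px; rewrite -irreducible_poly_coprime // => /Bezout_eq1_coprimepP[[u v]] /=.
move/(congr1 (map_poly iota)); rewrite rmorphD !rmorphM rmorph1 /= => E.
apply/negP => px; move/(congr1 (horner^~ x)): E; rewrite !hornerE (eqP fx) (eqP px).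
by move/eqP; rewrite !mulr0 addr0 eq_sym oner_eq0.
Qed.

Lemma irreducible_root_eq (F L : fieldType) (iota : {rmorphism F -> L})
    (f g : {poly F}) x :
  f \is monic -> irreducible_poly f -> root (map_poly iota f) x ->
  g \is monic -> irreducible_poly g -> root (map_poly iota g) x -> f = g.
Proof.
move=> mf If fx mg Ig gx; apply/eqP; rewrite -eqp_monic //.
by rewrite /eqp -(irreducible_root_dvdp _ If fx) gx -(irreducible_root_dvdp _ Ig gx).
Qed.

Lemma irreducible_minPoly (F : fieldType) (L : fieldExtType F) (x : L) (f : {poly F}) :
  minPoly 1%VS x = map_poly (in_alg L) f -> f \is monic /\ irreducible_poly f.
Proof.
move=> Ef; have mon_f : f \is monic by rewrite -(map_monic (in_alg L)) -Ef monic_minPoly.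
have sz_f : (1 < size f)%N.
  by rewrite -(size_map_poly (in_alg L)) -Ef size_minPoly.
split=> //; split=> // g sz_g g_f.
have g_min : map_poly (in_alg L) g %| minPoly 1 x by rewrite Ef dvdp_map.
have := minPoly_irr (K := 1%AS) (alg_polyOver _ _) g_min.
rewrite Ef eqp_map => /orP[// |]; rewrite -size_poly_eq1 size_map_poly.
by rewrite (negPf sz_g).
Qed.

Lemma minimal_polynomial_exists (F : fieldType) (L : fieldExtType F) (x : L) :
  exists f : {poly F}, [/\ f \is monic, irreducible_poly f,
    root (map_poly (in_alg L) f) x & size f = (\dim <<1; x>>).+1].
Proof.
have /polyOver1P[f Ef] := minPolyOver 1%AS x.
have [mon_f irr_f] := irreducible_minPoly Ef; exists f; split=> //.
  by rewrite -Ef root_minPoly.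
by rewrite -(size_map_poly (in_alg L)) -Ef size_minPoly dim_Fadjoin dimv1 muln1.
Qed.

Section FiniteExtension.

Variables (F : finFieldType) (L0 : fieldExtType F).
Local Notation L := (finvect_type L0).
Local Notation q := #|F|.
Local Notation N := (\dim {:L}).

(** In the field obtained by adjoining a root z of [f], Fermat's theorem makes z a root of the
    right-hand side. *)
Lemma irreducible_dvd_Xq (f : {poly F}) : irreducible_poly f ->
  f %| 'X^(q ^ (size f).-1) - 'X.
Proof.
move=> irr_f; have [K dimK [z fz _]] := irredp_FAdjoin irr_f.
rewrite -(irreducible_root_dvdp _ irr_f fz) rmorphB /= map_polyXn map_polyX.
rewrite rootE !hornerE subr_eq0 -dimK.
by have := Fermat's_little_theorem {:K}%AS z; rewrite memvf => /esym.
Qed.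

(** [f] divides X^|L| - X, the product of X - x over all x in L, so it is up to a unit a product of
    distinct linear factors. *)
Lemma card_roots_irreducible (f : {poly F}) :
  irreducible_poly f -> size f = N.+1 ->
  #|[set x : L | root (map_poly (in_alg L) f) x]| = N.
Proof.
move=> irr_f sz_f.
have : map_poly (in_alg L) f %| 'X^#|L| - 'X.
  have := irreducible_dvd_Xq irr_f; rewrite -(dvdp_map (in_alg L)) rmorphB /=.
  by rewrite map_polyXn map_polyX sz_f card_finvect.
rewrite finField_genPoly -big_enum => /dvdp_prod_XsubC[b Eb].
have Ub : uniq (mask b (enum L)) by rewrite mask_uniq ?enum_uniq.
apply: succn_inj; rewrite -[in RHS]sz_f -(size_map_poly (in_alg L)) (eqp_size Eb).
rewrite size_prod_XsubC -(card_uniqP Ub); congr _.+1.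
by apply: eq_card => x; rewrite inE (eqp_root Eb) root_prod_XsubC.
Qed.

End FiniteExtension.

(** * Orders of matrices and Singer cycles *)

Lemma horner_mx_eq0 (F : fieldType) N (T : 'M[F]_N.+1) p :
  irreducible_poly (char_poly T) -> (horner_mx T p == 0) = (char_poly T %| p).
Proof.
move=> irrT; apply/idP/idP => [/eqP pT0 | /dvdpP[r ->]]; last first.
  by rewrite rmorphM /= Cayley_Hamilton mulr0.
apply: contraTT isT => /(horner_mx_unit irrT).
by rewrite pT0 -[_ \in unitmx]/(_ \is a GRing.unit) unitr0.
Qed.

(** [T] and [x] are annihilated by the same polynomials, the multiples of [char_poly T]; this is
    applied to X^m - 1. *)
Lemma expmx_eq1_root (F L : fieldType) (iota : {rmorphism F -> L}) N (T : 'M[F]_N.+1) x m :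
  irreducible_poly (char_poly T) -> root (map_poly iota (char_poly T)) x ->
  (T ^+ m == 1) = (x ^+ m == 1).
Proof.
move=> irrT Tx; transitivity (horner_mx T ('X^m - 1) == 0).
  by rewrite rmorphB rmorphXn /= horner_mx_X rmorph1 subr_eq0.
rewrite horner_mx_eq0 // -(irreducible_root_dvdp _ irrT Tx).
by rewrite rmorphB /= map_polyXn rmorph1 rootE !hornerE subr_eq0.
Qed.

(** Dimension at least 2 excludes the zero matrix of size 1, whose characteristic polynomial X is
    irreducible. *)
Lemma irreducible_char_poly_unit (F : fieldType) N (T : 'M[F]_N.+2) :
  irreducible_poly (char_poly T) -> T \in unitmx.
Proof.
move=> irrT; rewrite -(horner_mx_X T) horner_mx_unit //.
by rewrite char_poly_ndvd ?polyX_eq0 ?size_polyX.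
Qed.

Lemma GL_order_dvdn (F : finFieldType) N (T : 'M[F]_N.+1) m :
  T \in unitmx -> (GL_order T %| m)%N = (T ^+ m == 1).
Proof.
move=> UT; rewrite /GL_order insubT.
by rewrite order_dvdn -val_eqE /= FinRing.val_unitX.
Qed.

Lemma GL_order_gt0 (F : finFieldType) N (T : 'M[F]_N.+1) :
  T \in unitmx -> (0 < GL_order T)%N.
Proof. by move=> UT; rewrite /GL_order insubT order_gt0. Qed.

(** Zero and the powers of [T] are q^(N+1) distinct elements of F[T], as many as there are
    polynomials of degree at most N. Hence each nonzero such polynomial takes at [T] a power of [T]
    as value, which is invertible, whereas a proper factorization of [f] would make a product of two
    such values equal to f(T) = 0. *)
Lemma singer_irreducible (F : finFieldType) N (T : 'M[F]_N.+1) :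
  T \in unitmx -> GL_order T = (#|F| ^ N.+1 - 1)%N -> irreducible_poly (char_poly T).
Proof.
move=> UT oT; set f := char_poly T; set m := (_ - 1)%N in oT.
have m_gt0 : (0 < m)%N by rewrite -oT GL_order_gt0.
have nz_f : f != 0 by rewrite -size_poly_gt0 size_char_poly.
have UTi i : T ^+ i \in unitmx by rewrite -[_ \in _]/(_ \is a GRing.unit) unitrX.
pose phi (u : 'rV[F]_N.+1) := horner_mx T (rVpoly u).
pose P := [set T ^+ i | i : 'I_m].
have cardP : #|P| = m.
  rewrite card_imset ?card_ord // => i j.
  wlog le_ij : i j / (i <= j)%N => [Hw | E].
    by case/orP: (leq_total i j) => le_ij E; [apply: Hw | apply/esym/Hw].
  have : T ^+ (j - i) == 1.
    apply/eqP/(mulrI (UTi i)); rewrite -exprD subnKC // mulr1; exact/esym.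
  rewrite -GL_order_dvdn // oT => /dvdnP[[|c] Ec]; apply: val_inj => /=.
    by apply/eqP; rewrite eqn_leq le_ij -subn_eq0 Ec mul0n.
  have : (j - i < m)%N by rewrite (leq_ltn_trans (leq_subr _ _)).
  by rewrite Ec mulSn ltnNge leq_addr.
have P0 : 0 \notin P.
  apply/imsetP => -[i _ E]; have := UTi i.
  by rewrite -E -[_ \in _]/(_ \is a GRing.unit) unitr0.
have sub_im : 0 |: P \subset phi @: [set: 'rV[F]_N.+1].
  apply/subsetP => M /setU1P[-> | /imsetP[i _ ->]].
    by apply/imsetP; exists 0; rewrite ?inE // /phi !linear0.
  (* Reducing X^i modulo [f] does not change its value at [T]. *)
  apply/imsetP; exists (poly_rV ('X^i %% f)); rewrite ?inE // /phi poly_rV_K; last first.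
    by rewrite -ltnS -(size_char_poly T) ltn_modp.
  rewrite -[in LHS](horner_mx_X T) -rmorphXn /= [in LHS](divp_eq 'X^i f).
  by rewrite rmorphD rmorphM /= Cayley_Hamilton mulr0 add0r.
have cardV : #|[set: 'rV[F]_N.+1]| = #|0 |: P|.
  rewrite cardsU1 P0 cardP cardsT card_mx mul1n /m.
  by rewrite subnKC // expn_gt0 (ltnW (finNzRing_gt1 F)).
have card_im : #|phi @: [set: 'rV[F]_N.+1]| = #|[set: 'rV[F]_N.+1]|.
  by apply/eqP; rewrite eqn_leq leq_imset_card cardV subset_leq_card.
have phi_inj : injective phi.
  by move=> u v; apply: (imset_injP (introT eqP card_im)); rewrite inE.
have im_phi : phi @: [set: 'rV[F]_N.+1] = 0 |: P.
  by apply/eqP; rewrite eq_sym eqEcard sub_im card_im cardV leqnn.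
have unit_phi (p : {poly F}) : p != 0 -> (size p <= N.+1)%N -> horner_mx T p \in unitmx.
  move=> nz_p sz_p; have : phi (poly_rV p) \in 0 |: P by rewrite -im_phi imset_f ?inE.
  rewrite /phi poly_rV_K // => /setU1P[p0 | /imsetP[i _ ->] //].
  case/eqP: nz_p; rewrite -(poly_rV_K sz_p).
  have -> : poly_rV p = 0 :> 'rV[F]_N.+1.
    by apply: phi_inj; rewrite /phi poly_rV_K // p0 !linear0.
  by rewrite linear0.
split=> [|g sz_g g_f]; first by rewrite size_char_poly.
rewrite -dvdp_size_eqp //; apply: contraT => ne_sz.
have [h Ef] := dvdpP _ _ g_f.
have [nz_h nz_g] : h != 0 /\ g != 0 by apply/norP; rewrite -mulf_eq0 -Ef.
have szE := size_mul nz_h nz_g; rewrite -Ef size_char_poly in szE.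
rewrite size_char_poly in ne_sz.
have g_gt0 : (0 < size g)%N by rewrite size_poly_gt0.
have h_gt0 : (0 < size h)%N by rewrite size_poly_gt0.
have [szh szg] : (size h <= N.+1)%N /\ (size g <= N.+1)%N.
  by move: sz_g ne_sz szE g_gt0 h_gt0; move: (size g) (size h) => a b; lia.
have : horner_mx T h *m horner_mx T g \in unitmx by rewrite unitmx_mul !unit_phi.
by rewrite mulmxE -rmorphM /= -Ef Cayley_Hamilton -[_ \in _]/(_ \is a GRing.unit) unitr0.
Qed.

Lemma dim_Fadjoin_root (F : fieldType) (L : fieldExtType F) (f : {poly F}) (x : L) :
  f \is monic -> irreducible_poly f -> root (map_poly (in_alg L) f) x ->
  (\dim <<1; x>>).+1 = size f.
Proof.
move=> mon_f irr_f fx; have [g [mon_g irr_g gx <-]] := minimal_polynomial_exists x.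
by rewrite (irreducible_root_eq mon_g irr_g gx mon_f irr_f fx).
Qed.

(** * Generators of the multiplicative group of L *)

Section PrimitiveElements.

Variables (F : finFieldType) (L0 : fieldExtType F).
Local Notation L := (finvect_type L0).
Local Notation q := #|F|.
Local Notation N := (\dim {:L}).

Definition primitive_elements : {set L} :=
  [set val u | u in [set u : {unit L} | generator [set: {unit L}] u]].

Lemma card_unit_finvect : #|[set: {unit L}]| = (q ^ N - 1)%N.
Proof. by rewrite card_finField_unit card_finvect subn1. Qed.

Lemma card_primitive_elements : #|primitive_elements| = totient (q ^ N - 1).
Proof.
rewrite card_imset; last exact: val_inj.
have /cyclicP[a Ga] := field_unit_group_cyclic [set: {unit L}]%G.
by rewrite -card_unit_finvect Ga totient_gen.
Qed.

Lemma primitive_elementsP (x : L) (u : {unit L}) : val u = x ->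
  (x \in primitive_elements) = (#[u]%g == q ^ N - 1)%N.
Proof.
move=> <-; rewrite mem_imset ?inE; last exact: val_inj.
have le_u : (#[u]%g <= #|[set: {unit L}]|)%N by rewrite dvdn_leq ?cardG_gt0 ?order_dvdG ?inE.
by rewrite /generator eq_sym eqEcard subsetT -orderE -card_unit_finvect eqn_leq le_u.
Qed.

(** If x has degree d, then x^(q^d) = x, so the order q^N - 1 of x divides q^d - 1, which forces N
    to be at most d. *)
Lemma primitive_elements_dim (x : L) : x \in primitive_elements -> \dim <<1; x>> = N.
Proof.
case/imsetP => u; rewrite inE => gen_u Ex.
have q_gt1 : (1 < q)%N := finNzRing_gt1 F.
apply/eqP; rewrite eqn_leq dimvS ?subvf //=; set d := \dim <<_; _>>.
have d_gt0 : (0 < d)%N by rewrite adim_gt0.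
have ou : #[u]%g = (q ^ N - 1)%N.
  apply/eqP; rewrite -(primitive_elementsP (erefl (val u))).
  by apply/imsetP; exists u; rewrite ?inE.
have : x ^+ (q ^ d) == x.
  by have := Fermat's_little_theorem <<1; x>>%AS x; rewrite memv_adjoin => /esym.
have qd_gt1 : (1 < q ^ d)%N by rewrite -(expn0 q) ltn_exp2l.
rewrite -(subnK (ltnW qd_gt1)) addn1 exprSr -[X in _ == X]mul1r.
have nz_x : x != 0 by rewrite Ex -unitfE (valP u).
rewrite (inj_eq (mulIf nz_x)) Ex -FinRing.val_unitX -FinRing.val_unit1 val_eqE -order_dvdn ou.
move/dvdn_leq; rewrite subn_gt0 => /(_ qd_gt1).
by rewrite leq_sub2rE ?(ltnW qd_gt1) // leq_exp2l.
Qed.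

(** [T] and its eigenvalue [x] have the same exponents d with d-th power 1, hence the same order. *)
Lemma primitive_elements_order m (T : 'M[F]_m.+2) (x : L) :
  irreducible_poly (char_poly T) -> root (map_poly (in_alg L) (char_poly T)) x ->
  (GL_order T == q ^ N - 1)%N = (x \in primitive_elements).
Proof.
move=> irrT Tx; have UT := irreducible_char_poly_unit irrT.
have oT d : (GL_order T %| d)%N = (x ^+ d == 1).
  by rewrite GL_order_dvdn // (expmx_eq1_root _ irrT Tx).
have Ux : x \is a GRing.unit.
  rewrite unitfE; apply/eqP => x0; have := oT (GL_order T).
  by rewrite dvdnn x0 expr0n gtn_eqF ?GL_order_gt0 // eq_sym oner_eq0.
rewrite (primitive_elementsP (u := Sub x Ux)) ?SubK //.
have ou d : (#[Sub x Ux : {unit L}]%g %| d)%N = (x ^+ d == 1).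
  by rewrite order_dvdn -val_eqE /= FinRing.val_unitX.
congr (_ == _); apply/eqP; rewrite eqn_dvd.
by apply/andP; split; [rewrite oT -ou | rewrite ou -oT].
Qed.

End PrimitiveElements.

(** * Double counting of matrices and eigenvalues *)

Section DoubleCount.

Variables (F : finFieldType) (L0 : fieldExtType F) (k : nat).
Local Notation L := (finvect_type L0).
Local Notation q := #|F|.
Hypothesis dimL : \dim {:L} = (2 * k.+1)%N.

(** Pairs (T, x) with x a root of [char_poly T] are counted twice: each T has 2k + 2 roots in L, all
    of them in [X]; for x in [X], the matrices are those whose characteristic polynomial is the
    minimal polynomial of x. *)
Lemma double_count (P : pred 'M[F]_(k.+1 * 2)) (X : {set L}) :
  (forall T (x : L), irreducible_poly (char_poly T) ->
     root (map_poly (in_alg L) (char_poly T)) x -> P T = (x \in X)) ->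
  (forall x : L, x \in X -> \dim <<1; x>> = (2 * k.+1)%N) ->
  (#|[set T : 'M[F]_(k.+1 * 2) |
       [&& block_companion T, irreducibleb (char_poly T) & P T]]| * (2 * k.+1)
   = #|X| * (q ^ (2 * k.+1 - 1) * (q - 1)))%N.
Proof.
move=> PX dimX; set S := [set T | _].
have szT (T : 'M[F]_(k.+1 * 2)) : size (char_poly T) = (2 * k.+1).+1.
  by rewrite size_char_poly mulnC.
pose r (T : 'M[F]_(k.+1 * 2)) (x : L) := root (map_poly (in_alg L) (char_poly T)) x.
transitivity (\sum_(T in S) \sum_(x : L | r T x) 1)%N.
  rewrite -sum_nat_const; apply: eq_bigr => T; rewrite inE => /and3P[_ /irreducibleP irrT _].
  rewrite sum1dep_card -dimL -[in LHS](@card_roots_irreducible F L0 (char_poly T)) //.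
  by rewrite dimL szT.
rewrite (exchange_big_dep (mem X)) /=; last first.
  by move=> T x; rewrite inE => /and3P[_ /irreducibleP irrT PT] rTx; rewrite -(PX T).
rewrite -sum_nat_const; apply: eq_bigr => x Xx.
have [f [mon_f irr_f fx sz_f]] := minimal_polynomial_exists x.
rewrite (dimX x Xx) in sz_f.
rewrite sum1dep_card -(card_block_companion_char_poly mon_f irr_f sz_f).
apply: eq_card => T; rewrite !inE.
apply/idP/idP => [/andP[/and3P[-> /irreducibleP irrT _] rTx] /= | /andP[bT /eqP ET]].
  by apply/eqP/(irreducible_root_eq (char_poly_monic T) irrT rTx).
have irrT : irreducible_poly (char_poly T) by rewrite ET.
have rTx : r T x by rewrite /r ET.
by rewrite bT (PX T x) // Xx rTx !andbT; apply/irreducibleP.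
Qed.

End DoubleCount.

(** * Moebius inversion over divisors *)

Lemma moebius_mul_dvd p j : prime p -> (0 < j)%N -> (p %| j)%N -> moebius (p * j) = 0.
Proof.
move=> pr_p j_gt0 p_j; have p_gt0 := prime_gt0 pr_p; rewrite /moebius muln_gt0 j_gt0 p_gt0 /=.
case: ifP => // /allP/(_ p); rewrite mem_primes pr_p muln_gt0 prime_gt0 // j_gt0 dvdn_mulr //.
move=> /(_ isT); rewrite lognM // logn_prime // eqxx add1n eqSS.
by rewrite -leqn0 leqNgt logn_gt0 mem_primes pr_p j_gt0 p_j.
Qed.

Lemma moebius_mul_ndvd p j : prime p -> (0 < j)%N -> ~~ (p %| j)%N ->
  moebius (p * j) = - moebius j.
Proof.
move=> pr_p j_gt0 p_j; have p_gt0 := prime_gt0 pr_p; rewrite /moebius muln_gt0 j_gt0 p_gt0 /=.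
have pj : perm_eq (primes (p * j)) (p :: primes j).
  apply: uniq_perm; rewrite /= ?primes_uniq ?mem_primes ?(negPf p_j) ?andbF //.
  by move=> r; rewrite primesM // primes_prime // !inE.
rewrite (perm_all _ pj) (perm_size pj) /= lognM // logn_prime // eqxx.
have -> : logn p j = 0%N.
  by apply/eqP; rewrite -leqn0 leqNgt logn_gt0 mem_primes (negPf p_j) !andbF.
rewrite addn0 eqxx /=.
have -> : all (fun r => logn r (p * j) == 1%N) (primes j)
        = all (fun r => logn r j == 1%N) (primes j).
  apply: eq_in_all => r; rewrite mem_primes => /and3P[pr_r _ r_j].
  rewrite lognM // logn_prime //; have [Erp | //] := eqVneq r p.
  by rewrite -Erp r_j in p_j.
by case: ifP => _; rewrite ?oppr0 // exprS mulN1r.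
Qed.

Lemma big_divisors_multiples (V : nmodType) (G : nat -> V) N c :
  (0 < N)%N -> (c %| N)%N ->
  \sum_(d <- divisors N | (c %| d)%N) G d = \sum_(e <- divisors (N %/ c)) G (c * e)%N.
Proof.
move=> N_gt0 c_N; have c_gt0 := dvdn_gt0 N_gt0 c_N.
have Nc_gt0 : (0 < N %/ c)%N by rewrite divn_gt0 // dvdn_leq.
rewrite -big_filter -[RHS](big_map (muln c) xpredT G); apply: perm_big.
apply: uniq_perm; rewrite ?filter_uniq ?divisors_uniq //.
  by rewrite map_inj_uniq ?divisors_uniq // => a b /eqP; rewrite eqn_pmul2l // => /eqP.
move=> d; rewrite mem_filter -dvdn_divisors //; apply/andP/mapP => [[c_d d_N] | [e]].
  exists (d %/ c)%N; last by rewrite muln_divA // mulKn.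
  by rewrite -dvdn_divisors // -(dvdn_pmul2l c_gt0) !muln_divA // !mulKn.
rewrite -dvdn_divisors // => e_N ->; rewrite dvdn_mulr //; split=> //.
by rewrite -(dvdn_pmul2l c_gt0) muln_divA // mulKn in e_N.
Qed.

Lemma big_divisors_rev (V : nmodType) (G : nat -> V) N : (0 < N)%N ->
  \sum_(d <- divisors N) G (N %/ d)%N = \sum_(d <- divisors N) G d.
Proof.
move=> N_gt0; rewrite -[LHS](big_map (fun d => N %/ d)%N xpredT G); apply: perm_big.
have divK d : (d \in divisors N -> N %/ (N %/ d) = d)%N.
  by rewrite -dvdn_divisors // => d_N; rewrite divnA // mulKn.
apply: uniq_perm; rewrite ?divisors_uniq //.
  by rewrite map_inj_in_uniq ?divisors_uniq //; apply: (can_in_inj (g := fun d => (N %/ d)%N)).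
move=> d; apply/mapP/idP => [[e] | d_N].
  by rewrite -!dvdn_divisors // => e_N ->; apply: dvdn_div.
exists (N %/ d)%N; last by rewrite divK.
by move: d_N; rewrite -!dvdn_divisors // => d_N; apply: dvdn_div.
Qed.

(** Take a prime p dividing N. Divisors p j contribute 0 when p divides j, and [- moebius j]
    otherwise, which cancels the contribution of the divisors prime to p. *)
Lemma sum_moebius N : (0 < N)%N -> \sum_(d <- divisors N) moebius d = (N == 1%N)%:R.
Proof.
move=> N_gt0; have [-> | N_ne1] := eqVneq N 1%N.
  by rewrite /= big_seq1.
have N_gt1 : (1 < N)%N by rewrite ltn_neqAle eq_sym N_ne1.
have pr_p := pdiv_prime N_gt1; have p_N := pdiv_dvd N; set p := pdiv N in pr_p p_N.
have Np_gt0 : (0 < N %/ p)%N by rewrite divn_gt0 ?(prime_gt0 pr_p) // dvdn_leq.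
rewrite (bigID (fun d => p %| d)%N) /= big_divisors_multiples //.
rewrite (bigID (fun d => p %| d)%N) /= big_seq_cond big1 ?add0r; last first.
  move=> j /andP[]; rewrite -dvdn_divisors // => j_N p_j.
  by rewrite moebius_mul_dvd // (dvdn_gt0 Np_gt0).
rewrite big_seq_cond (eq_bigr (fun j => - moebius j)); last first.
  move=> j /andP[]; rewrite -dvdn_divisors // => j_N p_j.
  by rewrite moebius_mul_ndvd // (dvdn_gt0 Np_gt0).
rewrite -big_seq_cond sumrN; apply/eqP; rewrite addrC subr_eq0; apply/eqP.
(* N and N / p have the same divisors not divisible by p. *)
rewrite -big_filter -[RHS]big_filter; apply: perm_big.
apply: uniq_perm; rewrite ?filter_uniq ?divisors_uniq // => d.
rewrite !mem_filter -!dvdn_divisors //; case: (boolP (p %| d)%N) => //= p_d.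
have co_pd : coprime d p by rewrite coprime_sym prime_coprime.
apply/idP/idP => d_N; last exact: dvdn_trans d_N (dvdn_div p_N).
by rewrite -(Gauss_dvdl _ co_pd) divnK.
Qed.

(** For d = c e the quotients N / d run through the divisors of N / c. Below, c is the degree of an
    element of L. *)
Lemma sum_moebius_multiples N c : (0 < N)%N -> (c %| N)%N ->
  \sum_(d <- divisors N | (c %| d)%N) moebius (N %/ d) = (c == N)%:R.
Proof.
move=> N_gt0 c_N; have c_gt0 := dvdn_gt0 N_gt0 c_N.
have Nc_gt0 : (0 < N %/ c)%N by rewrite divn_gt0 // dvdn_leq.
rewrite big_divisors_multiples //.
under eq_bigr => e _ do rewrite divnMA; rewrite big_divisors_rev // sum_moebius //.
by rewrite -(eqn_pmul2r c_gt0) divnK // mul1n eq_sym.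
Qed.

(** * Subfields of L and elements of full degree *)

(** The subfield is fixed by the d-th power of the Frobenius generator, an automorphism of order N /
    d. *)
Lemma subfield_of_dim (F : finFieldType) (L : splittingFieldType F) (N := \dim {:L}) d :
  (d %| N)%N -> exists E : {subfield L}, \dim E = d.
Proof.
move=> d_N; have N_gt0 : (0 < N)%N by rewrite adim_gt0.
have d_gt0 := dvdn_gt0 N_gt0 d_N.
have [/= a /eqP gen_a _] := finField_galois_generator (sub1v {:L}).
have oa : #[a]%g = N.
  by rewrite orderE -gen_a -galois_dim ?finField_galois ?sub1v // dimv1 divn1.
exists [aspace of fixedField <[a ^+ d]>%g].
have := dim_fixedField <[a ^+ d]>%G.
rewrite -orderE orderXdiv ?oa //.
have := field_dimS (subvf [aspace of fixedField <[a ^+ d]>%g]).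
rewrite -/N; move: (\dim (fixedField _)) => e /= e_N E.
have e_gt0 := dvdn_gt0 N_gt0 e_N.
have Nd_gt0 : (0 < N %/ d)%N by rewrite divn_gt0 // dvdn_leq.
by apply/eqP; rewrite -(eqn_pmul2l Nd_gt0) divnK // E divnK.
Qed.

Section FixedPoints.

Variables (F : finFieldType) (L0 : fieldExtType F).
Local Notation L := (finvect_type L0).
Local Notation q := #|F|.
Local Notation N := (\dim {:L}).

Lemma fixed_point_subfield (E : {subfield L}) (x : L) :
  (x ^+ (q ^ \dim E) == x) = (x \in E).
Proof. by rewrite (Fermat's_little_theorem E x). Qed.

(** Fixed points of the q^d-power map form the subfield of dimension d, whose dimension is a
    multiple of that of F(x); conversely the q-power map of exponent deg x is iterated. *)
Lemma fixed_point_dvdn d (x : L) : (d %| N)%N ->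
  (x ^+ (q ^ d) == x) = (\dim <<1; x>> %| d)%N.
Proof.
move=> d_N; apply/idP/idP => [|/dvdnP[j ->]].
  have [E <-] := subfield_of_dim d_N; rewrite fixed_point_subfield => Ex.
  apply: (field_dimS (F := <<1; x>>%AS)); apply/FadjoinP; split=> //; exact: sub1v.
have /eqP xd : x ^+ (q ^ \dim <<1; x>>) == x.
  by rewrite (fixed_point_subfield <<1; x>>%AS) memv_adjoin.
elim: j => [|j IHj]; first by rewrite expr1.
by rewrite mulSn expnD exprM xd.
Qed.

Lemma card_fixed_points d : (d %| N)%N ->
  #|[set x : L | (\dim <<1; x>> %| d)%N]| = (q ^ d)%N.
Proof.
move=> d_N; have [E Ed] := subfield_of_dim d_N.
rewrite -[in RHS]Ed -card_vspace.
by apply: eq_card => x; rewrite inE -fixed_point_dvdn // -Ed fixed_point_subfield.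
Qed.

(** Write q^d as the number of x whose degree divides d and exchange the sums: x then has weight
    equal to the sum of mu(N / d) over the multiples d of its degree, which is 1 in degree N and 0
    otherwise. *)
Lemma card_generating_elements :
  #|[set x : L | \dim <<1; x>> == N]|%:R
    = \sum_(d <- divisors N) moebius (N %/ d) * q%:R ^+ d.
Proof.
have N_gt0 : (0 < N)%N by rewrite adim_gt0.
transitivity (\sum_(d <- divisors N)
                \sum_(x : L | (\dim <<1; x>> %| d)%N) moebius (N %/ d)); last first.
  rewrite big_seq [RHS]big_seq; apply: eq_bigr => d; rewrite -dvdn_divisors // => d_N.
  rewrite sumr_const -natrX mulr_natr -(card_fixed_points d_N).
  by congr (_ *+ _); apply: eq_card => x; rewrite inE.
rewrite (exchange_big_dep xpredT) //=.
rewrite (eq_bigr (fun x : L => (\dim <<1; x>> == N)%:R)) => [|x _]; last first.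
  by rewrite sum_moebius_multiples // (field_dimS (F := <<1; x>>%AS) (E := {:L}%AS)) ?subvf.
rewrite -natr_sum -sum1_card; congr _%:R; rewrite [LHS]big_mkcond.
by apply: eq_bigr => x _; rewrite inE.
Qed.

End FixedPoints.

(** * Primitive polynomials, and the four counts *)

Lemma primitive_polynomial_irreducible (F : finFieldType) (f : {poly F}) :
  primitive_polynomial f -> f \is monic /\ irreducible_poly f.
Proof. by case=> L [a [_ _ _ Ef]]; apply: irreducible_minPoly Ef. Qed.

(** [T] and the root [a] have the same order. Fermat's theorem bounds it above; it is bounded below
    because the powers of [a] exhaust the nonzero elements of L. *)
Lemma primitive_polynomial_GL_order (F : finFieldType) N (T : 'M[F]_N.+2) :
  primitive_polynomial (char_poly T) -> GL_order T = (#|F| ^ N.+2 - 1)%N.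
Proof.
move=> prim; have [_ irrT] := primitive_polynomial_irreducible prim.
have UT := irreducible_char_poly_unit irrT.
case: prim => L [a []]; rewrite size_char_poly => -[dimL] nz_a gen_a Ea.
have Ta : root (map_poly (in_alg L) (char_poly T)) a by rewrite -Ea root_minPoly.
have oT d : (GL_order T %| d)%N = (a ^+ d == 1).
  by rewrite GL_order_dvdn // (expmx_eq1_root _ irrT Ta).
have cardL : #|finvect_type L| = (#|F| ^ N.+2)%N by rewrite card_finvect dimL.
have qN_gt0 : (0 < #|F| ^ N.+2)%N by rewrite expn_gt0 (ltnW (finNzRing_gt1 F)).
have qN_gt1 : (1 < #|F| ^ N.+2)%N by rewrite -(expn0 #|F|) ltn_exp2l ?finNzRing_gt1.
have m_gt0 : (0 < #|F| ^ N.+2 - 1)%N by rewrite subn_gt0.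
apply/eqP; rewrite eqn_leq; apply/andP; split.
  rewrite dvdn_leq // oT -(inj_eq (mulIf nz_a)) mul1r -exprSr subn1 prednK //.
  by rewrite -cardL (expf_card (a : finvect_type L)).
have d_gt0 := GL_order_gt0 UT.
rewrite subn1 -cardL -(cardC1 (0 : finvect_type L)) -[X in (_ <= X)%N]card_ord.
pose g (i : 'I_(GL_order T)) : finvect_type L := a ^+ i.
apply: leq_trans (leq_imset_card g predT); apply/subset_leq_card/subsetP => x /gen_a[j ->].
have ad1 : a ^+ GL_order T = 1 by apply/eqP; rewrite -oT.
apply/imsetP; exists (Ordinal (ltn_pmod j d_gt0)) => //=.
by rewrite /g /= expr_mod.
Qed.

Theorem theorem4p4 (F : finFieldType) (n : nat) (hn : (0 < n)%N) :
  let q := #|F| in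
  [/\ forall f : {poly F},
        f \is monic -> irreducible_poly f -> size f = (2 * n).+1 ->
        #|[set T : 'M[F]_(n * 2) | block_companion T & char_poly T == f]|
          = (q ^ (2 * n - 1) * (q - 1))%N,
      forall f : {poly F},
        primitive_polynomial f -> size f = (2 * n).+1 ->
        #|[set T : 'M[F]_(n * 2) |
             block_companion_singer T & char_poly T == f]|
          = (q ^ (2 * n - 1) * (q - 1))%N,
      #|[set T : 'M[F]_(n * 2) | block_companion_singer T]|%:R
        = (totient (q ^ (2 * n) - 1))%:R / (2 * n)%:R
            * (q%:R ^+ (2 * n - 1) * (q%:R - 1)) :> rat
    & #|[set T : 'M[F]_(n * 2) |
           block_companion T & irreducibleb (char_poly T)]|%:R
        = 1 / (2 * n)%:R
            * (\sum_(d <- divisors (2 * n))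
                 (moebius ((2 * n) %/ d))%:~R * q%:R ^+ d)
            * (q%:R ^+ (2 * n - 1) * (q%:R - 1)) :> rat].
Proof.
case: n hn => // k _ q.
have [L0 dimL] := finField_ext_exists F (isT : (0 < 2 * k.+1)%N).
have nz_N : (2 * k.+1)%:R != 0 :> rat by rewrite pnatr_eq0.
have q_gt0 : (0 < q)%N := ltnW (finNzRing_gt1 F).
have natc : (q ^ (2 * k.+1 - 1) * (q - 1))%:R
    = q%:R ^+ (2 * k.+1 - 1) * (q%:R - 1) :> rat.
  by rewrite natrM natrX natrB.
split.
- exact: card_block_companion_char_poly.
- move=> f prim_f sz_f; have [mon_f irr_f] := primitive_polynomial_irreducible prim_f.
  rewrite -(card_block_companion_char_poly mon_f irr_f sz_f); apply: eq_card => T.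
  rewrite !inE; case: (char_poly T =P f) => [ET | _]; rewrite ?andbF // !andbT.
  have irrT : irreducible_poly (char_poly T) by rewrite ET.
  have UT : T \in unitmx by apply: (@irreducible_char_poly_unit _ (k * 2) T).
  have oT : GL_order T = (#|F| ^ (2 * k.+1) - 1)%N.
    rewrite [(2 * k.+1)%N]mulnC.
    by apply: (@primitive_polynomial_GL_order _ (k * 2) T); rewrite ET.
  by apply/and3P/idP => [[] // | bT]; split=> //; apply/eqP.
(* Singer cycles correspond to generators of the multiplicative group of L. Irreducibility, required
   by [double_count], follows from the order; conversely it yields invertibility. *)
- have := double_count (L0 := L0) dimL
    (P := fun T => GL_order T == (q ^ (2 * k.+1) - 1)%N) (X := primitive_elements L0).
  rewrite card_primitive_elements dimL -/q => count.
  have {}count := count _ _.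
  rewrite -natc mulrAC -natrM -count; last 2 first.
  + move=> T x irrT Tx; rewrite -dimL.
    exact: (@primitive_elements_order _ _ (k * 2) T).
  + by move=> x /primitive_elements_dim->.
  rewrite natrM mulfK //; congr _%:R; apply: eq_card => T; rewrite !inE.
  rewrite /block_companion_singer; case: (block_companion T) => //; rewrite !andTb.
  apply/andP/andP => [[UT oT] | [/irreducibleP irrT oT]]; split=> //.
    apply/irreducibleP; apply: (@singer_irreducible _ (k * 2).+1 T) => //.
    by rewrite [(2 * k.+1)%N]mulnC in oT; apply/eqP.
  exact: (@irreducible_char_poly_unit _ (k * 2) T).
(* All irreducible characteristic polynomials are allowed here, so [X] consists of all elements of
   degree 2n. *)
- have := double_count (L0 := L0) dimL (P := xpredT)
    (X := [set x : finvect_type L0 | \dim <<1; x>> == (2 * k.+1)%N]).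
  move=> count; have {}count := count _ _.
  have cardX := @card_generating_elements F L0; rewrite dimL in cardX.
  (* The Moebius sum was computed in the integers and is carried over to the rationals. *)
  have {}cardX := congr1 (intr : int -> rat) cardX.
  rewrite rmorph_nat rmorph_sum /= in cardX.
  have sumE : \sum_(d <- divisors (2 * k.+1)) (moebius ((2 * k.+1) %/ d))%:~R * q%:R ^+ d
      = #|[set x : finvect_type L0 | \dim <<1; x>> == (2 * k.+1)%N]|%:R :> rat.
    by rewrite cardX; apply: eq_bigr => d _; rewrite rmorphM rmorphXn /= rmorph_nat.
  rewrite -natc sumE.
  rewrite div1r -mulrA -natrM -count; last 2 first.
  + move=> T x irrT Tx; rewrite inE -eqSS.
    by rewrite (dim_Fadjoin_root (char_poly_monic T) irrT Tx) size_char_poly mulnC eqxx.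
  + by move=> x; rewrite inE => /eqP.
  rewrite [X in _ * X]natrM mulrCA mulVf // mulr1; congr _%:R; apply: eq_card => T.
  by rewrite !inE andbT.
Qed.
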